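(* Let $n\geq 1$ be an integer, let $A_1,\ldots ,A_n$ be residuated lattices, let $A=\prod _{i=1}^nA_i$ with componentwise operations and, for each $i\in \{1,\ldots ,n\}$, let $pr_i:A\rightarrow A_i$ be the canonical projection. Let $F$ be an arbitrary filter of $A$ and, for every $i$, let $F_i=pr_i(F)$ (a filter of $A_i$). Then: (1) for each $i\in \{1,\ldots ,n\}$, the Boolean morphism $\mathcal{B}(pr_i):\mathcal{B}(A)\rightarrow \mathcal{B}(A_i)$ is surjective; (2) the residuated lattices $A/F$ and $\prod _{i=1}^nA_i/F_i$ are isomorphic; (3) $F$ has the Boolean Lifting Property (in $A$) if and only if $F_i$ has the Boolean Lifting Property (in $A_i$) for every $i\in \{1,\ldots ,n\}$; (4) the Boolean morphism $\mathcal{B}(p_F):\mathcal{B}(A)\to\mathcal{B}(A/F)$ is injective if and only if the Boolean morphism $\mathcal{B}(p_{F_i}):\mathcal{B}(A_i)\to\mathcal{B}(A_i/F_i)$ is injective for every $i\in \{1,\ldots ,n\}$.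
   Context: A residuated lattice is a commutative integral bounded one: a structure $(A,\vee ,\wedge ,\odot ,\rightarrow ,0,1)$ such that $(A,\vee ,\wedge ,0,1)$ is a bounded lattice, $(A,\odot ,1)$ is a commutative monoid, and $a\leq b\rightarrow c$ iff $a\odot b\leq c$ for all $a,b,c$. Write $a\leftrightarrow b=(a\rightarrow b)\wedge (b\rightarrow a)$. $\mathcal{B}(A)$ is the set of complemented elements of the bounded lattice reduct of $A$; it is a Boolean algebra with the induced operations. A residuated lattice morphism $\varphi:L\to M$ restricts to a Boolean morphism $\mathcal{B}(\varphi):\mathcal{B}(L)\to\mathcal{B}(M)$, $x\mapsto\varphi(x)$. A filter of $A$ is a nonempty subset closed under $\odot$ and upward closed. For a filter $F$, $A/F$ is the quotient residuated lattice by the congruence $a\equiv b$ iff $a\leftrightarrow b\in F$, with classes $a/F$, and $p_F:A\to A/F$ is the canonical surjection. A filter $F$ of $A$ has the Boolean Lifting Property (in $A$) iff for every $f\in \mathcal{B}(A/F)$ there is $e\in \mathcal{B}(A)$ with $e/F=f$, i.e. iff $\mathcal{B}(p_F)$ is surjective. *)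

(* Defs.v *)
From HB Require Import structures.
From mathcomp Require Import all_boot all_order.
From mathcomp Require Import generic_quotient.
From mathcomp Require Import boolp classical_sets functions.

Set Implicit Arguments.
Unset Strict Implicit.
Unset Printing Implicit Defensive.

Import Order.Theory.
Local Open Scope classical_set_scope.
Local Open Scope quotient_scope.
Local Open Scope order_scope.

Reserved Notation "x ⊙ y" (at level 40, left associativity).
Reserved Notation "x ⟶ y" (at level 55, right associativity).
Reserved Notation "x ⟷ y" (at level 55, no associativity).

(* Integrality is built in: the unit of the monoid is the top element.  The
   carrier of a tbLatticeType is a choiceType, which is no restriction since
   boolp endows every type with such a structure. *)
HB.mixin Record TBLattice_isResiduated d T of Order.TBLattice d T := {
  rmul : T -> T -> T;
  rimp : T -> T -> T;
  rmulA : associative rmul;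
  rmulC : commutative rmul;
  rmul1x : left_id (\top : T) rmul;
  le_rimp : forall x y z : T, (x <= rimp y z) = (rmul x y <= z);
}.

#[short(type="residuatedLatticeType")]
HB.structure Definition ResiduatedLattice d :=
  { T of Order.TBLattice d T & TBLattice_isResiduated d T }.

Notation "x ⊙ y" := (rmul x y) : order_scope.
Notation "x ⟶ y" := (rimp x y) : order_scope.

Definition rbiimp d (A : residuatedLatticeType d) (x y : A) : A :=
  (x ⟶ y) `&` (y ⟶ x).
Notation "x ⟷ y" := (rbiimp x y) : order_scope.

HB.mixin Record isResiduatedMorphism d (A : residuatedLatticeType d)
    d' (B : residuatedLatticeType d') (f : A -> B) := {
  rmorphM_subproof : {morph f : x y / x ⊙ y};
  rmorphI_subproof : {morph f : x y / x ⟶ y};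
}.

(* TBLatticeMorphism only preserves \bot and \top, hence LatticeMorphism. *)
HB.structure Definition ResiduatedMorphism d (A : residuatedLatticeType d)
    d' (B : residuatedLatticeType d') :=
  { f of @Order.LatticeMorphism d A d' B f
       & @Order.TBLatticeMorphism d A d' B f
       & isResiduatedMorphism d A d' B f }.

Notation "{ 'rlmorphism' A -> B }" :=
  (@ResiduatedMorphism.type _ A%type _ B%type)
  (at level 0, A at level 98, B at level 99,
   format "{ 'rlmorphism'  A  ->  B }") : type_scope.

Definition rl_isomorphic d (A : residuatedLatticeType d)
    d' (B : residuatedLatticeType d') : Prop :=
  exists f : {rlmorphism A -> B}, bijective f.

Section Theory.
Context d (A : residuatedLatticeType d).
Implicit Types x y z t : A.

Lemma rmulx1 x : x ⊙ \top = x.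
Proof. by rewrite rmulC rmul1x. Qed.

Lemma rimp_eval x y : (x ⟶ y) ⊙ x <= y.
Proof. by rewrite -le_rimp. Qed.

Lemma le_rmul x y z t : x <= y -> z <= t -> x ⊙ z <= y ⊙ t.
Proof.
have mono (a b c : A) : a <= b -> a ⊙ c <= b ⊙ c.
  by move=> ab; rewrite -le_rimp (le_trans ab)// le_rimp.
move=> xy zt; apply: (le_trans (mono _ _ _ xy)).
by rewrite ![y ⊙ _]rmulC mono.
Qed.

Lemma rmul_lel x y : x ⊙ y <= x.
Proof. by rewrite -[leRHS]rmulx1 le_rmul. Qed.

Lemma rmul_ler x y : x ⊙ y <= y.
Proof. by rewrite rmulC rmul_lel. Qed.

Lemma rimp_eq1 x y : (x ⟶ y == \top) = (x <= y).
Proof. by rewrite -le1x le_rimp rmul1x. Qed.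

Lemma rimp_curry x y z : (x ⊙ y) ⟶ z = x ⟶ (y ⟶ z).
Proof.
apply/le_anti/andP; split; first by rewrite !le_rimp -rmulA rimp_eval.
by rewrite le_rimp rmulA -le_rimp -le_rimp.
Qed.

Lemma rimp_meetr x y z : x ⟶ (y `&` z) = (x ⟶ y) `&` (x ⟶ z).
Proof.
apply/le_anti/andP; split.
  rewrite lexI !le_rimp; apply/andP; split.
    exact: le_trans (rimp_eval _ _) (leIl _ _).
  exact: le_trans (rimp_eval _ _) (leIr _ _).
by rewrite le_rimp lexI -!le_rimp leIl leIr.
Qed.

Lemma rimp_joinl x y z : (x `|` y) ⟶ z = (x ⟶ z) `&` (y ⟶ z).
Proof.
apply/le_anti/andP; split.
  rewrite lexI !le_rimp; apply/andP; split.
    exact: le_trans (le_rmul (lexx _) (leUl _ _)) (rimp_eval _ _).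
  exact: le_trans (le_rmul (lexx _) (leUr _ _)) (rimp_eval _ _).
rewrite le_rimp rmulC -le_rimp leUx !le_rimp !(rmulC _ (_ `&` _)) -!le_rimp.
by rewrite leIl leIr.
Qed.

Lemma rimp_trans x y z : (x ⟶ y) ⊙ (y ⟶ z) <= x ⟶ z.
Proof.
rewrite le_rimp (rmulC (x ⟶ y)) -rmulA.
exact: le_trans (le_rmul (lexx _) (rimp_eval _ _)) (rimp_eval _ _).
Qed.

End Theory.

Definition boolean_center d (A : residuatedLatticeType d) : set A :=
  [set x | exists y, x `&` y = \bot /\ x `|` y = \top].
Arguments boolean_center {d} A.

Section BooleanMorphism.
Context d (A : residuatedLatticeType d) d' (B : residuatedLatticeType d').
Variable f : {rlmorphism A -> B}.

Lemma boolean_center_morph (x : boolean_center A) :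
  f (val x) \in boolean_center B.
Proof.
have [y [xy0 xy1]] := set_valP x; apply/mem_set; exists (f y).
split; rewrite -?omorphI -?omorphU ?xy0 ?xy1.
  exact: (omorph0 f).
exact: (omorph1 f).
Qed.

Definition boolean_map (x : boolean_center A) : boolean_center B :=
  SigSub (boolean_center_morph x).

End BooleanMorphism.

Record rlFilter d (A : residuatedLatticeType d) := RLFilter {
  rlfilter_set :> set A;
  rlfilter_nonempty : rlfilter_set !=set0;
  rlfilter_mul : forall x y,
    rlfilter_set x -> rlfilter_set y -> rlfilter_set (x ⊙ y);
  rlfilter_up : forall x y, rlfilter_set x -> x <= y -> rlfilter_set y;
}.

Section Quotient.
Context d (A : residuatedLatticeType d).
Variable F : rlFilter A.
Local Notation FS := (rlfilter_set F).
Implicit Types x y z : A.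

Lemma rlfilter_top : FS \top.
Proof. by have [x Fx] := rlfilter_nonempty F; exact: rlfilter_up Fx (lex1 _). Qed.

Lemma rlfilter_meet x y : FS (x `&` y) <-> FS x /\ FS y.
Proof.
split=> [Fxy|[Fx Fy]].
  by split; apply: (rlfilter_up Fxy); rewrite ?leIl ?leIr.
by apply: (rlfilter_up (rlfilter_mul Fx Fy)); rewrite lexI rmul_lel rmul_ler.
Qed.

Lemma rlfilter_le x y : x <= y -> FS (x ⟶ y).
Proof. by rewrite -rimp_eq1 => /eqP ->; exact: rlfilter_top. Qed.

Lemma rlfilter_trans x y z : FS (x ⟶ y) -> FS (y ⟶ z) -> FS (x ⟶ z).
Proof.
move=> xy yz.
exact: rlfilter_up (rlfilter_mul xy yz) (rimp_trans _ _ _).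
Qed.

Definition rlcong : rel A := fun x y => `[< FS (x ⟷ y) >].

Lemma rlcongP x y : reflect (FS (x ⟶ y) /\ FS (y ⟶ x)) (rlcong x y).
Proof. by apply: (iffP (asboolP _)); rewrite rlfilter_meet. Qed.

Lemma rlcong_refl : reflexive rlcong.
Proof. by move=> x; apply/rlcongP; split; exact: rlfilter_le. Qed.

Lemma rlcong_sym : symmetric rlcong.
Proof. by move=> x y; apply/rlcongP/rlcongP => -[]. Qed.

Lemma rlcong_trans : transitive rlcong.
Proof.
move=> y x z /rlcongP[xy yx] /rlcongP[yz zy]; apply/rlcongP.
by split; [exact: rlfilter_trans xy yz | exact: rlfilter_trans zy yx].
Qed.

Canonical rlcong_equiv := EquivRel rlcong rlcong_refl rlcong_sym rlcong_trans.

Definition rlquot := {eq_quot rlcong}.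
HB.instance Definition _ := EqQuotient.on rlquot.
HB.instance Definition _ := Choice.on rlquot.

Definition rlpi (x : A) : rlquot := \pi x.

Lemma rlpi_eqP x y : reflect (FS (x ⟶ y) /\ FS (y ⟶ x)) (rlpi x == rlpi y).
Proof. by rewrite /rlpi piE; exact: rlcongP. Qed.

Lemma rlpi_repr (u : rlquot) : rlpi (repr u) = u.
Proof. exact: reprK. Qed.

Lemma repr_rlpi x : FS (repr (rlpi x) ⟶ x) /\ FS (x ⟶ repr (rlpi x)).
Proof. by apply/rlpi_eqP; rewrite rlpi_repr. Qed.

(* x/F <= y/F iff x ⟶ y \in F; this is the order of the quotient lattice,
   equivalently (x `&` y)/F = x/F. *)
Definition rlquot_le (u v : rlquot) : bool := `[< FS (repr u ⟶ repr v) >].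
Definition rlquot_meet (u v : rlquot) : rlquot := rlpi (repr u `&` repr v).
Definition rlquot_join (u v : rlquot) : rlquot := rlpi (repr u `|` repr v).
Definition rlquot_mul (u v : rlquot) : rlquot := rlpi (repr u ⊙ repr v).
Definition rlquot_imp (u v : rlquot) : rlquot := rlpi (repr u ⟶ repr v).

Lemma rlquot_leP x y : reflect (FS (x ⟶ y)) (rlquot_le (rlpi x) (rlpi y)).
Proof.
have [rx xr] := repr_rlpi x; have [ry yr] := repr_rlpi y.
apply: (iffP (asboolP _)) => xy.
  exact: rlfilter_trans (rlfilter_trans xr xy) ry.
exact: rlfilter_trans (rlfilter_trans rx xy) yr.
Qed.

Lemma rlquot_le_refl : reflexive rlquot_le.
Proof. by move=> u; apply/asboolP; exact: rlfilter_le. Qed.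

Lemma rlquot_le_anti : antisymmetric rlquot_le.
Proof.
move=> u v /andP[/asboolP uv /asboolP vu].
by rewrite -[u]rlpi_repr -[v]rlpi_repr; apply/eqP/rlpi_eqP.
Qed.

Lemma rlquot_le_trans : transitive rlquot_le.
Proof.
by move=> v u w /asboolP uv /asboolP vw; apply/asboolP/(rlfilter_trans uv vw).
Qed.

HB.instance Definition _ := Order.Le_isPOrder.Build d rlquot
  rlquot_le_refl rlquot_le_anti rlquot_le_trans.

Lemma le_rlpi x y : reflect (FS (x ⟶ y)) (rlpi x <= rlpi y).
Proof. exact: rlquot_leP. Qed.

Lemma rlquot_lexI (u v w : rlquot) :
  (u <= rlquot_meet v w) = (u <= v) && (u <= w).
Proof.
rewrite -[u]rlpi_repr -[in RHS](rlpi_repr v) -[in RHS](rlpi_repr w).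
apply/le_rlpi/andP; rewrite rimp_meetr rlfilter_meet.
  by case=> uv uw; split; exact/le_rlpi.
by case=> /le_rlpi uv /le_rlpi uw.
Qed.

Lemma rlquot_leUx (u v w : rlquot) :
  (rlquot_join u v <= w) = (u <= w) && (v <= w).
Proof.
rewrite -[w]rlpi_repr -[in RHS](rlpi_repr u) -[in RHS](rlpi_repr v).
apply/le_rlpi/andP; rewrite rimp_joinl rlfilter_meet.
  by case=> uw vw; split; exact/le_rlpi.
by case=> /le_rlpi uw /le_rlpi vw.
Qed.

HB.instance Definition _ := Order.POrder_MeetJoin_isLattice.Build d rlquot
  rlquot_lexI rlquot_leUx.

Lemma rlquot_le0x (u : rlquot) : rlpi \bot <= u.
Proof. by rewrite -[u]rlpi_repr; apply/le_rlpi/rlfilter_le/le0x. Qed.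

Lemma rlquot_lex1 (u : rlquot) : u <= rlpi \top.
Proof. by rewrite -[u]rlpi_repr; apply/le_rlpi/rlfilter_le/lex1. Qed.

HB.instance Definition _ := Order.hasBottom.Build d rlquot rlquot_le0x.
HB.instance Definition _ := Order.hasTop.Build d rlquot rlquot_lex1.

Lemma rlpi_homo : {homo rlpi : x y / x <= y}.
Proof. by move=> x y xy; apply/le_rlpi/rlfilter_le. Qed.

Lemma rlpi_meet : {morph rlpi : x y / x `&` y}.
Proof.
have mono (a a' b b' : A) : FS (a ⟶ a') -> FS (b ⟶ b') ->
    FS ((a `&` b) ⟶ (a' `&` b')).
  move=> aa' bb'; rewrite rimp_meetr rlfilter_meet; split.
    exact: rlfilter_trans (rlfilter_le (leIl _ _)) aa'.
  exact: rlfilter_trans (rlfilter_le (leIr _ _)) bb'.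
move=> x y; have [rx xr] := repr_rlpi x; have [ry yr] := repr_rlpi y.
by apply/eqP/rlpi_eqP; split; exact: mono.
Qed.

Lemma rlpi_join : {morph rlpi : x y / x `|` y}.
Proof.
have mono (a a' b b' : A) : FS (a ⟶ a') -> FS (b ⟶ b') ->
    FS ((a `|` b) ⟶ (a' `|` b')).
  move=> aa' bb'; rewrite rimp_joinl rlfilter_meet; split.
    exact: rlfilter_trans aa' (rlfilter_le (leUl _ _)).
  exact: rlfilter_trans bb' (rlfilter_le (leUr _ _)).
move=> x y; have [rx xr] := repr_rlpi x; have [ry yr] := repr_rlpi y.
by apply/eqP/rlpi_eqP; split; exact: mono.
Qed.

Lemma rlpi_mul x y : rlpi (x ⊙ y) = rlquot_mul (rlpi x) (rlpi y).
Proof.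
have mono (a a' b b' : A) : FS (a ⟶ a') -> FS (b ⟶ b') -> FS (a ⊙ b ⟶ a' ⊙ b').
  move=> aa' bb'; apply: (rlfilter_up (rlfilter_mul aa' bb')).
  rewrite le_rimp rmulA -(rmulA (a ⟶ a')) (rmulC (b ⟶ b')) rmulA -rmulA.
  by rewrite le_rmul// rimp_eval.
have [rx xr] := repr_rlpi x; have [ry yr] := repr_rlpi y.
by apply/eqP/rlpi_eqP; split; exact: mono.
Qed.

Lemma rlpi_imp x y : rlpi (x ⟶ y) = rlquot_imp (rlpi x) (rlpi y).
Proof.
have mono (a a' b b' : A) : FS (a' ⟶ a) -> FS (b ⟶ b') ->
    FS ((a ⟶ b) ⟶ (a' ⟶ b')).
  move=> aa' bb'; apply: (rlfilter_up (rlfilter_mul aa' bb')).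
  rewrite le_rimp rmulC rmulA (rmulC (a ⟶ b)).
  exact: le_trans (le_rmul (rimp_trans _ _ _) (lexx _)) (rimp_trans _ _ _).
have [rx xr] := repr_rlpi x; have [ry yr] := repr_rlpi y.
by apply/eqP/rlpi_eqP; split; exact: mono.
Qed.

Lemma rlquot_mulA : associative rlquot_mul.
Proof.
move=> u v w; rewrite -[u]rlpi_repr -[v]rlpi_repr -[w]rlpi_repr.
by rewrite -!rlpi_mul rmulA.
Qed.

Lemma rlquot_mulC : commutative rlquot_mul.
Proof. by move=> u v; rewrite /rlquot_mul rmulC. Qed.

Lemma rlquot_mul1x : left_id (\top : rlquot) rlquot_mul.
Proof.
by move=> u; rewrite -[u]rlpi_repr -[\top]/(rlpi \top) -rlpi_mul rmul1x.
Qed.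

Lemma rlquot_le_imp (u v w : rlquot) :
  (u <= rlquot_imp v w) = (rlquot_mul u v <= w).
Proof.
rewrite -[u]rlpi_repr -[v]rlpi_repr -[w]rlpi_repr -rlpi_mul -rlpi_imp.
by apply/le_rlpi/le_rlpi; rewrite rimp_curry.
Qed.

HB.instance Definition _ := TBLattice_isResiduated.Build d rlquot
  rlquot_mulA rlquot_mulC rlquot_mul1x rlquot_le_imp.

HB.instance Definition _ :=
  Order.isOrderMorphism.Build d A d rlquot rlpi rlpi_homo.
HB.instance Definition _ :=
  Order.isLatticeMorphism.Build d A d rlquot rlpi rlpi_meet rlpi_join.
HB.instance Definition _ :=
  Order.isBLatticeMorphism.Build d A d rlquot rlpi erefl.
HB.instance Definition _ :=
  Order.isTLatticeMorphism.Build d A d rlquot rlpi erefl.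
HB.instance Definition _ :=
  isResiduatedMorphism.Build d A d rlquot rlpi rlpi_mul rlpi_imp.

Definition boolean_lifting_property : Prop :=
  forall f : rlquot, boolean_center rlquot f ->
    exists2 e : A, boolean_center A e & rlpi e = f.

End Quotient.

Section Product.
Context d (I : Type) (A : I -> residuatedLatticeType d).

Definition rlprod : Type := forall i, A i.
HB.instance Definition _ := Choice.copy rlprod (forall i, A i).

Implicit Types x y z : rlprod.

Definition rlprod_le x y : bool := `[< forall i, x i <= y i >].
Definition rlprod_bot : rlprod := fun i => \bot.
Definition rlprod_top : rlprod := fun i => \top.
Definition rlprod_meet x y : rlprod := fun i => x i `&` y i.
Definition rlprod_join x y : rlprod := fun i => x i `|` y i.
Definition rlprod_mul x y : rlprod := fun i => x i ⊙ y i.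
Definition rlprod_imp x y : rlprod := fun i => x i ⟶ y i.

Lemma rlprod_le_refl : reflexive rlprod_le.
Proof. by move=> x; apply/asboolP. Qed.

Lemma rlprod_le_anti : antisymmetric rlprod_le.
Proof.
move=> x y /andP[/asboolP xy /asboolP yx]; apply: functional_extensionality_dep.
by move=> i; apply/le_anti; rewrite xy yx.
Qed.

Lemma rlprod_le_trans : transitive rlprod_le.
Proof.
move=> y x z /asboolP xy /asboolP yz; apply/asboolP => i.
exact: le_trans (xy i) (yz i).
Qed.

HB.instance Definition _ := Order.Le_isPOrder.Build d rlprod
  rlprod_le_refl rlprod_le_anti rlprod_le_trans.

Lemma le_rlprod x y : reflect (forall i, x i <= y i) (x <= y).
Proof. exact: asboolP. Qed.

Lemma rlprod_lexI x y z : (x <= rlprod_meet y z) = (x <= y) && (x <= z).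
Proof.
apply/le_rlprod/andP => [xyz|[/le_rlprod xy /le_rlprod xz] i].
  by split; apply/le_rlprod => i; have := xyz i; rewrite lexI => /andP[].
by rewrite lexI xy xz.
Qed.

Lemma rlprod_leUx x y z : (rlprod_join x y <= z) = (x <= z) && (y <= z).
Proof.
apply/le_rlprod/andP => [xyz|[/le_rlprod xz /le_rlprod yz] i].
  by split; apply/le_rlprod => i; have := xyz i; rewrite leUx => /andP[].
by rewrite leUx xz yz.
Qed.

HB.instance Definition _ := Order.POrder_MeetJoin_isLattice.Build d rlprod
  rlprod_lexI rlprod_leUx.

Lemma rlprod_le0x x : rlprod_bot <= x.
Proof. by apply/le_rlprod => i; exact: le0x. Qed.

Lemma rlprod_lex1 x : x <= rlprod_top.
Proof. by apply/le_rlprod => i; exact: lex1. Qed.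

HB.instance Definition _ := Order.hasBottom.Build d rlprod rlprod_le0x.
HB.instance Definition _ := Order.hasTop.Build d rlprod rlprod_lex1.

Lemma rlprod_mulA : associative rlprod_mul.
Proof.
by move=> x y z; apply: functional_extensionality_dep => i; exact: rmulA.
Qed.

Lemma rlprod_mulC : commutative rlprod_mul.
Proof.
by move=> x y; apply: functional_extensionality_dep => i; exact: rmulC.
Qed.

Lemma rlprod_mul1x : left_id (\top : rlprod) rlprod_mul.
Proof.
by move=> x; apply: functional_extensionality_dep => i; exact: rmul1x.
Qed.

Lemma rlprod_le_imp x y z : (x <= rlprod_imp y z) = (rlprod_mul x y <= z).
Proof.
by apply/le_rlprod/le_rlprod => xyz i; have := xyz i; rewrite le_rimp.
Qed.

HB.instance Definition _ := TBLattice_isResiduated.Build d rlprod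
  rlprod_mulA rlprod_mulC rlprod_mul1x rlprod_le_imp.

Definition rlproj (i : I) (x : rlprod) : A i := x i.

Section Projection.
Variable i : I.

Lemma rlproj_homo : {homo rlproj i : x y / x <= y}.
Proof. by move=> x y /le_rlprod. Qed.

HB.instance Definition _ := Order.isOrderMorphism.Build d rlprod d (A i)
  (rlproj i) rlproj_homo.
HB.instance Definition _ := Order.isLatticeMorphism.Build d rlprod d (A i)
  (rlproj i) (fun _ _ => erefl) (fun _ _ => erefl).
HB.instance Definition _ := Order.isBLatticeMorphism.Build d rlprod d (A i)
  (rlproj i) erefl.
HB.instance Definition _ := Order.isTLatticeMorphism.Build d rlprod d (A i)
  (rlproj i) erefl.
HB.instance Definition _ := isResiduatedMorphism.Build d rlprod d (A i)
  (rlproj i) (fun _ _ => erefl) (fun _ _ => erefl).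

End Projection.
End Product.

Section ProjectionFilter.
Context d (I : eqType) (A : I -> residuatedLatticeType d).
Variables (F : rlFilter (rlprod A)) (i : I).

Let Fi : set (A i) := rlproj i @` F.

Lemma proj_filter_nonempty : Fi !=set0.
Proof. by have [x Fx] := rlfilter_nonempty F; exists (x i), x. Qed.

Lemma proj_filter_mul a b : Fi a -> Fi b -> Fi (a ⊙ b).
Proof.
by move=> [x Fx <-] [y Fy <-]; exists (x ⊙ y) => //; exact: rlfilter_mul.
Qed.

Lemma proj_filter_up a b : Fi a -> a <= b -> Fi b.
Proof.
move=> [x Fx <-] xb; exists (dfwith x b : rlprod A); last exact: dfwith_in.
apply: (rlfilter_up Fx); apply/le_rlprod => j.
by case: dfwithP.
Qed.

Definition proj_filter : rlFilter (A i) :=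
  RLFilter proj_filter_nonempty proj_filter_mul proj_filter_up.

End ProjectionFilter.

(* Main.v *)
Require Import Defs.
From HB Require Import structures.
From mathcomp Require Import all_boot all_order.
From mathcomp Require Import generic_quotient.
From mathcomp Require Import boolp classical_sets functions.

(** A filter [F] of a finite product is the product of its projections
    ([rlfilter_prodP]): if every coordinate of [x] is the coordinate of some
    member of [F], the meet of these finitely many members lies in [F] and below
    [x].  Applied to [x ⟶ y], this says that the congruence and the order
    modulo [F] are tested coordinatewise modulo the filters [F_i], so that
    x/F |-> (x_i/F_i)_i is an isomorphism from A/F onto the product of the
    A_i/F_i.

    The other claims use that an element of a product is complemented iff all
    its coordinates are ([boolean_center_prodP]).  A complemented element of one
    factor is then completed by [\bot] to a complemented element of the product,
    which gives the surjectivity of B(pr_i).  Through the isomorphism, lifting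
    complemented elements along [F], or separating them modulo [F], becomes the
    same problem in each factor independently. *)

Set Implicit Arguments.
Unset Strict Implicit.
Unset Printing Implicit Defensive.

Import Order.Theory.
Local Open Scope classical_set_scope.
Local Open Scope order_scope.

Section BooleanCenter.
Context d (A : residuatedLatticeType d) d' (B : residuatedLatticeType d').

Lemma boolean_center_bot : boolean_center A \bot.
Proof. by exists \top; rewrite meet0x join0x. Qed.

Lemma boolean_center_image (f : {rlmorphism A -> B}) (x : A) :
  boolean_center A x -> boolean_center B (f x).
Proof.
move=> Bx; exact: set_mem (boolean_center_morph f (SigSub (mem_set Bx))).
Qed.

Lemma boolean_center_bij_reflect (f : {rlmorphism A -> B}) (x : A) :
    bijective f ->
  boolean_center B (f x) -> boolean_center A x.
Proof.
move=> [g fK gK] [y]; rewrite -[y]gK => -[xy0 xy1]; exists (g y).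
split; apply: (can_inj fK).
  exact: etrans (omorphI f _ _) (etrans xy0 (esym (omorph0 f))).
exact: etrans (omorphU f _ _) (etrans xy1 (esym (omorph1 f))).
Qed.

Lemma boolean_map_injP (f : {rlmorphism A -> B}) :
  injective (boolean_map f) <->
  (forall x y, boolean_center A x -> boolean_center A y -> f x = f y -> x = y).
Proof.
split=> [finj x y Bx By fxy|finj x y /(congr1 val) /= fxy].
  have /finj/(congr1 val) // :
    boolean_map f (SigSub (mem_set Bx)) = boolean_map f (SigSub (mem_set By)).
  exact: val_inj.
by apply: val_inj; apply: finj fxy; exact: set_valP.
Qed.

End BooleanCenter.

Section BooleanCenterProduct.
Context d (I : eqType) (A : I -> residuatedLatticeType d).

Lemma boolean_center_prodP (x : rlprod A) :
  boolean_center (rlprod A) x <-> forall i, boolean_center (A i) (x i).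
Proof.
split=> [Bx i|Bx]; first exact: (boolean_center_image (rlproj i)) Bx.
exists (fun i => projT1 (cid (Bx i))).
by split; apply: functional_extensionality_dep => i;
  case: (projT2 (cid (Bx i))).
Qed.

Lemma boolean_center_dfwith_bot (i : I) (a : A i) :
    boolean_center (A i) a ->
  boolean_center (rlprod A) (dfwith (\bot : rlprod A) a).
Proof.
move=> Ba; apply/boolean_center_prodP => j.
by case: dfwithP => // k _; exact: boolean_center_bot.
Qed.

Lemma boolean_map_proj_surj (i : I) :
  set_surj [set: boolean_center (rlprod A)] [set: boolean_center (A i)]
    (boolean_map (rlproj i)).
Proof.
move=> a _; have Ba := boolean_center_dfwith_bot (set_valP a).
exists (SigSub (mem_set Ba)) => //.
by apply: val_inj; exact: dfwith_in.
Qed.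

End BooleanCenterProduct.

Section FiniteProduct.
Context d (I : finType) (A : I -> residuatedLatticeType d).
Variable F : rlFilter (rlprod A).

(** Finiteness of the index type is needed here: in an infinite product of
    nontrivial factors, the families equal to [\top] at all but finitely many
    indices form a proper filter, all of whose projections are improper. *)
Lemma rlfilter_prodP (x : rlprod A) :
  rlfilter_set F x <-> forall i, rlfilter_set (proj_filter F i) (x i).
Proof.
split=> [Fx i|Fx]; first by exists x.
pose y i := s2val (cid2 (Fx i)).
apply: (@rlfilter_up _ _ F (\meet_i y i)); last first.
  apply/le_rlprod => i; rewrite -(s2valP' (cid2 (Fx i))).
  by have /le_rlprod := meets_inf y (erefl : predT i) : \meet_i y i <= y i.
elim/big_ind: _ => [|u v Fu Fv|i _]; first exact: rlfilter_top.
  exact/rlfilter_meet.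
exact: (s2valP (cid2 (Fx i))).
Qed.

Lemma rlpi_prodP (x y : rlprod A) :
  rlpi F x = rlpi F y <-> forall i, rlpi (proj_filter F i) (x i) = rlpi _ (y i).
Proof.
split=> [/eqP/rlpi_eqP[/rlfilter_prodP xy /rlfilter_prodP yx] i|xy].
  by apply/eqP/rlpi_eqP.
by apply/eqP/rlpi_eqP; split; apply/rlfilter_prodP => i;
  have /eqP/rlpi_eqP[] := xy i.
Qed.

(** The isomorphism x/F |-> (x_i/F_i)_i, computed on the chosen representative
    of the class; [rlquot_to_prodE] shows that any representative will do. *)
Definition rlquot_to_prod (u : rlquot F) :
    rlprod (fun i => rlquot (proj_filter F i)) :=
  fun i => rlpi (proj_filter F i) (repr u i).

Lemma rlquot_to_prodE (x : rlprod A) :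
  rlquot_to_prod (rlpi F x) = fun i => rlpi (proj_filter F i) (x i).
Proof.
by apply: functional_extensionality_dep; apply/rlpi_prodP; rewrite rlpi_repr.
Qed.

Lemma rlquot_to_prod_homo : {homo rlquot_to_prod : u v / u <= v}.
Proof.
move=> u v; rewrite -[u]rlpi_repr -[v]rlpi_repr => /le_rlpi/rlfilter_prodP uv.
by rewrite !rlquot_to_prodE; apply/le_rlprod => i; apply/le_rlpi/uv.
Qed.

Lemma rlquot_to_prod_meet : {morph rlquot_to_prod : u v / u `&` v}.
Proof.
move=> u v; rewrite -[u]rlpi_repr -[v]rlpi_repr -rlpi_meet !rlquot_to_prodE.
by apply: functional_extensionality_dep => i; exact: rlpi_meet.
Qed.

Lemma rlquot_to_prod_join : {morph rlquot_to_prod : u v / u `|` v}.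
Proof.
move=> u v; rewrite -[u]rlpi_repr -[v]rlpi_repr -rlpi_join !rlquot_to_prodE.
by apply: functional_extensionality_dep => i; exact: rlpi_join.
Qed.

Lemma rlquot_to_prod_mul : {morph rlquot_to_prod : u v / u ⊙ v}.
Proof.
move=> u v; rewrite -[u]rlpi_repr -[v]rlpi_repr.
rewrite -[_ ⊙ _]/(rlquot_mul _ _) -rlpi_mul !rlquot_to_prodE.
by apply: functional_extensionality_dep => i; exact: rlpi_mul.
Qed.

Lemma rlquot_to_prod_imp : {morph rlquot_to_prod : u v / u ⟶ v}.
Proof.
move=> u v; rewrite -[u]rlpi_repr -[v]rlpi_repr.
rewrite -[_ ⟶ _]/(rlquot_imp _ _) -rlpi_imp !rlquot_to_prodE.
by apply: functional_extensionality_dep => i; exact: rlpi_imp.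
Qed.

Lemma rlquot_to_prod_bot : rlquot_to_prod \bot = \bot.
Proof. exact: rlquot_to_prodE. Qed.

Lemma rlquot_to_prod_top : rlquot_to_prod \top = \top.
Proof. exact: rlquot_to_prodE. Qed.

HB.instance Definition _ := Order.isOrderMorphism.Build d (rlquot F) d
  (rlprod (fun i => rlquot (proj_filter F i))) rlquot_to_prod
  rlquot_to_prod_homo.
HB.instance Definition _ := Order.isLatticeMorphism.Build d (rlquot F) d
  (rlprod (fun i => rlquot (proj_filter F i))) rlquot_to_prod
  rlquot_to_prod_meet rlquot_to_prod_join.
HB.instance Definition _ := Order.isBLatticeMorphism.Build d (rlquot F) d
  (rlprod (fun i => rlquot (proj_filter F i))) rlquot_to_prod
  rlquot_to_prod_bot.
HB.instance Definition _ := Order.isTLatticeMorphism.Build d (rlquot F) d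
  (rlprod (fun i => rlquot (proj_filter F i))) rlquot_to_prod
  rlquot_to_prod_top.
HB.instance Definition _ := isResiduatedMorphism.Build d (rlquot F) d
  (rlprod (fun i => rlquot (proj_filter F i))) rlquot_to_prod
  rlquot_to_prod_mul rlquot_to_prod_imp.

Lemma rlquot_to_prod_bij : bijective rlquot_to_prod.
Proof.
exists (fun v : rlprod (fun i => rlquot (proj_filter F i)) =>
  rlpi F (fun i => repr (v i))) => [u|v].
  rewrite -[RHS]rlpi_repr; apply/rlpi_prodP => i; exact: rlpi_repr.
rewrite rlquot_to_prodE; apply: functional_extensionality_dep => i.
exact: rlpi_repr.
Qed.

Lemma boolean_center_rlpi_prodP (x : rlprod A) :
  boolean_center (rlquot F) (rlpi F x) <->
  forall i, boolean_center (rlquot (proj_filter F i)) (rlpi _ (x i)).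
Proof.
have prodP := @boolean_center_prodP d I (fun i => rlquot (proj_filter F i)).
split=> [/(boolean_center_image rlquot_to_prod)|Bx].
  by rewrite [X in boolean_center _ X]rlquot_to_prodE => /prodP.
apply: (boolean_center_bij_reflect rlquot_to_prod_bij).
by rewrite [X in boolean_center _ X]rlquot_to_prodE; apply/prodP.
Qed.

Lemma boolean_lifting_prodP :
  boolean_lifting_property F <->
  forall i, boolean_lifting_property (proj_filter F i).
Proof.
split=> [liftF i f|liftF u].
  rewrite -[f]rlpi_repr; set a := repr f => Ba.
  (* Only the [i]-th class [f] has to be lifted: put [\bot] elsewhere. *)
  have [|e Be /rlpi_prodP ea] := liftF (rlpi F (dfwith (\bot : rlprod A) a)).
    apply/boolean_center_rlpi_prodP => j; case: dfwithP => // k _.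
    exact: (boolean_center_bot (rlquot (proj_filter F k))).
  exists (e i); first by move/boolean_center_prodP: Be.
  by rewrite ea dfwith_in.
rewrite -[u]rlpi_repr => /boolean_center_rlpi_prodP Bu.
have lift i := liftF i _ (Bu i).
exists (fun i => s2val (cid2 (lift i))).
  by apply/boolean_center_prodP => i; exact: (s2valP (cid2 (lift i))).
by apply/rlpi_prodP => i; exact: (s2valP' (cid2 (lift i))).
Qed.

Lemma boolean_map_rlpi_injP :
  injective (boolean_map (rlpi F)) <->
  forall i, injective (boolean_map (rlpi (proj_filter F i))).
Proof.
split=> [/boolean_map_injP injF i|injF]; apply/boolean_map_injP.
  move=> a b Ba Bb ab; rewrite -(dfwith_in (\bot : rlprod A) a).
  rewrite -(dfwith_in (\bot : rlprod A) b); congr (_ i).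
  apply: injF; [exact: boolean_center_dfwith_bot..|].
  apply/rlpi_prodP => j; have [<-|ij] := eqVneq i j.
    by rewrite !dfwith_in.
  by rewrite !dfwith_out.
move=> x y /boolean_center_prodP Bx /boolean_center_prodP By /rlpi_prodP xy.
apply: (@functional_extensionality_dep I A x y) => i.
have /boolean_map_injP injFi := injF i; exact: injFi (Bx i) (By i) (xy i).
Qed.

End FiniteProduct.

Theorem proposition5p7 (n : nat) (hn : (1 <= n)%N) (d : Order.disp_t)
    (A : 'I_n -> residuatedLatticeType d) (F : rlFilter (rlprod A)) :
  [/\ (forall i : 'I_n,
         set_surj [set: boolean_center (rlprod A)] [set: boolean_center (A i)]
           (boolean_map (rlproj i))),
      rl_isomorphic (rlquot F) (rlprod (fun i => rlquot (proj_filter F i))),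
      boolean_lifting_property F <->
        (forall i : 'I_n, boolean_lifting_property (proj_filter F i))
    & injective (boolean_map (rlpi F)) <->
        (forall i : 'I_n, injective (boolean_map (rlpi (proj_filter F i))))].
Proof.
split.
- exact: boolean_map_proj_surj.
- exists (@rlquot_to_prod d 'I_n A F); exact: rlquot_to_prod_bij.
- exact: boolean_lifting_prodP.
- exact: boolean_map_rlpi_injP.
Qed.
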